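(* Let $G$ be a finite non-Abelian AC-group with center $Z(G)$, and let $n$ be the number of distinct centralizers of non-central elements of $G$. Then $\mathcal{E}(\Gamma_G)=2\big(|G|-|Z(G)|-n\big)$.
   Context: For $g$ in a group $G$, $C_G(g)=\{a\in G\mid ag=ga\}$. A group $G$ is an AC-group if $C_G(g)$ is Abelian for every $g\in G\setminus Z(G)$. For a finite non-Abelian group $G$, the commuting graph $\Gamma_G$ is the simple undirected graph with vertex set $G\setminus Z(G)$ in which two distinct vertices $a,b$ are adjacent iff $ab=ba$. The energy $\mathcal{E}(\Gamma)$ of a finite graph $\Gamma$ is the sum of the absolute values of the eigenvalues of its adjacency matrix, counted with multiplicity. *)

(* Defs.v *)
From HB Require Import structures.
From mathcomp Require Import all_boot all_order all_algebra all_fingroup all_solvable all_field.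

Set Implicit Arguments.
Unset Strict Implicit.
Unset Printing Implicit Defensive.

Import GroupScope Order.TTheory GRing.Theory Num.Theory.

Definition AC_group (gT : finGroupType) (G : {group gT}) : Prop :=
  forall g : gT, g \in G :\: 'Z(G) -> abelian 'C_G[g].

Record sgraph := SGraph {
  vertex :> finType;
  adj : rel vertex;
  adj_sym : symmetric adj;
  adj_irrefl : irreflexive adj
}.

Section Commuting.

Variables (gT : finGroupType) (G : {group gT}).

Definition noncentral : finType := {x : gT | x \in G :\: 'Z(G)}.

Definition commuting_rel : rel noncentral :=
  [rel a b | (a != b) && (val a * val b == val b * val a)].

Fact commuting_rel_sym : symmetric commuting_rel.
Proof. by move=> a b; rewrite /commuting_rel /= (eq_sym a) (eq_sym (val a * val b)). Qed.

Fact commuting_rel_irrefl : irreflexive commuting_rel.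
Proof. by move=> a; rewrite /commuting_rel /= eqxx. Qed.

Definition commuting_graph : sgraph :=
  SGraph commuting_rel_sym commuting_rel_irrefl.

Definition noncentral_centralizers : {set {set gT}} :=
  [set 'C_G[g] | g in G :\: 'Z(G)].

End Commuting.

Section Energy.

Local Open Scope ring_scope.

Variable C : numClosedFieldType.

Definition adjacency_mx (X : sgraph) : 'M[C]_#|X| :=
  \matrix_(i, j) (adj (enum_val i) (enum_val j))%:R.

(* The roots of the (monic) characteristic polynomial, each repeated according
   to its multiplicity; the sequence is unique up to permutation. *)
Definition eigenvalues n (A : 'M[C]_n) : seq C :=
  sval (closed_field_poly_normal (char_poly A)).

Definition energy (X : sgraph) : C :=
  \sum_(z <- eigenvalues (adjacency_mx X)) `|z|.

End Energy.

(* Main.v *)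
Require Import Defs.
From mathcomp Require Import all_boot all_order all_algebra all_fingroup all_solvable all_field.
From mathcomp Require Import ring.

Import GroupScope Order.TTheory GRing.Theory Num.Theory.

(** In an AC-group two non-central elements commute iff they have the same
    centralizer, so the commuting graph is a disjoint union of cliques, one for
    each of the [n] centralizers. Its adjacency matrix is therefore [P P^T - 1],
    where [P] is the vertex/clique incidence matrix, and [P^T P] is the diagonal
    matrix of the clique sizes [c_k]. Comparing the characteristic polynomials
    of [P P^T] and [P^T P], the eigenvalues are the numbers [c_k - 1] together
    with [-1], the latter [N - n] times, where [N] is the number of vertices.
    Hence the energy is [sum_k (c_k - 1) + (N - n) = 2 (N - n)]. *)

Section Sylvester.

Local Open Scope ring_scope.

(** Evaluate the determinant of the block matrix [M] twice, clearing [A] by a left and then by a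
    right multiplication. The powers of [x] avoid any division. *)
Lemma det_sylvester (R : comNzRingType) m n (x : R)
    (A : 'M[R]_(m, n)) (B : 'M[R]_(n, m)) :
  x ^+ n * \det (x%:M - A *m B) = x ^+ m * \det (x%:M - B *m A).
Proof.
pose M := block_mx x%:M A B 1%:M.
have detM : \det M = \det (x%:M - A *m B).
  have: block_mx 1%:M (- A) 0 1%:M *m M = block_mx (x%:M - A *m B) 0 B 1%:M.
    rewrite mulmx_block !mul1mx !mul0mx !add0r mulNmx mulmx1.
    by rewrite addrN.
  move/(congr1 determinant).
  by rewrite det_mulmx det_ublock det_lblock !det1 !mul1r mulr1.
have: M *m block_mx 1%:M (- A) 0 x%:M = block_mx x%:M 0 B (x%:M - B *m A).
  rewrite mulmx_block !mulmx1 !mulmx0 !addr0 mul1mx !mulmxN.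
  by rewrite mul_scalar_mx mul_mx_scalar addNr addrC.
move/(congr1 determinant).
rewrite det_mulmx det_ublock det_lblock det1 mul1r !det_scalar detM.
by rewrite mulrC.
Qed.

End Sylvester.

Section CliqueUnion.

Local Open Scope ring_scope.

Variables (C : numClosedFieldType) (X : sgraph) (K : finType) (f : X -> K).
Hypothesis adjE : forall a b : X, adj a b = (a != b) && (f a == f b).

Let c (k : K) : nat := #|[set a | f a == k]|.

Let P : 'M[C]_(#|X|, #|K|) := \matrix_(i, j) (f (enum_val i) == enum_val j)%:R.

Lemma clique_adjacency : adjacency_mx C X = P *m P^T - 1%:M.
Proof.
apply/matrixP=> i j; rewrite !mxE adjE (inj_eq enum_val_inj).
(* Row [i] of [P] has a single nonzero entry, at the label of vertex [i]. *)
rewrite (bigD1 (enum_rank (f (enum_val i)))) //= big1 => [|k kP].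
  rewrite !mxE enum_rankK eqxx mul1r addr0 [f _ == f (enum_val i)]eq_sym.
  by case: eqVneq => [->|_] /=; rewrite ?eqxx ?subrr ?subr0.
rewrite !mxE; case: eqP => [fi|]; last by rewrite mul0r.
by rewrite fi enum_valK eqxx in kP.
Qed.

Lemma clique_gram : P^T *m P = diag_mx (\row_k (c (enum_val k))%:R).
Proof.
apply/matrixP=> k l; rewrite !mxE.
under eq_bigr do rewrite !mxE -natrM mulnb.
rewrite -natr_sum -(big_enum_val (A := X) (fun a => nat_of_bool
  ((f a == enum_val k) && (f a == enum_val l)))) /=.
case: eqVneq => [<-|neq_kl].
  rewrite mulr1n; congr (_%:R); rewrite /c -sum1dep_card [RHS]big_mkcond /=.
  by apply: eq_big => // a _; rewrite andbb; case: eqP.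
rewrite big1 ?mulr0n // => a _; case: eqP => // ->.
by rewrite (inj_eq enum_val_inj) (negPf neq_kl).
Qed.

Lemma clique_char_poly :
  ('X + 1) ^+ #|K| * char_poly (adjacency_mx C X) =
  ('X + 1) ^+ #|X| * \prod_k ('X - ((c k)%:R - 1)%:P).
Proof.
pose PX := map_mx polyC P.
(* The summand [- 1%:M] of the adjacency matrix shifts the indeterminate, so [det_sylvester] applies
   with [x := 'X + 1]. *)
have -> : char_poly (adjacency_mx C X) = \det (('X + 1)%:M - PX *m PX^T).
  rewrite /char_poly /char_poly_mx clique_adjacency map_mxB map_mxM map_trmx.
  by rewrite map_scalar_mx opprB addrA -raddfD.
rewrite det_sylvester map_trmx -map_mxM clique_gram map_diag_mx.
congr (_ * _).
rewrite -diag_const_mx -raddfB /= det_diag.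
rewrite [RHS](reindex (@enum_val K K)).
  by apply: eq_bigr => k _; rewrite !mxE polyCB opprB addrA.
exact: onW_bij (enum_val_bij K).
Qed.

Lemma sum_clique_card : (\sum_k c k = #|X|)%N.
Proof.
rewrite -sum1_card (partition_big f xpredT) //=.
by apply: eq_bigr => k _; rewrite /c -sum1dep_card.
Qed.

(* [K] may be larger than the image of [f]: a label with empty fibre gives the
   spurious value [|0 - 1| = 1], compensated by the exponent [#|K|] above. *)
Lemma clique_norm k :
  `|(c k)%:R - 1| =
    (c k)%:R + 1 - (if k \in f @: [set: X] then 2%:R else 0) :> C.
Proof.
have [/imsetP[a _ ->] | k_notin] := boolP (k \in _).
  rewrite ger0_norm ?subr_ge0 ?ler1n; first by ring.
  by apply/card_gt0P; exists a; rewrite inE.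
suff ->: c k = 0%N by rewrite sub0r normrN1 add0r subr0.
apply/eqP; rewrite cards_eq0 -subset0; apply/subsetP=> a; rewrite !inE => /eqP fa.
by rewrite -fa imset_f ?inE in k_notin.
Qed.

Lemma clique_energy :
  energy C X = 2%:R * (#|X|%:R - #|f @: [set: X]|%:R).
Proof.
have eigE : char_poly (adjacency_mx C X) =
    \prod_(z <- eigenvalues (adjacency_mx C X)) ('X - z%:P).
  rewrite /eigenvalues; case: closed_field_poly_normal => s /= {1}->.
  by rewrite (monicP (char_poly_monic _)) scale1r.
(* With both sides split into linear factors, the two lists of roots agree up to permutation, hence
   so do their sums of norms. *)
have X1 n : ('X + 1 : {poly C}) ^+ n = \prod_(z <- nseq n (-1)) ('X - z%:P).
  by rewrite big_nseq polyCN opprK; elim: n => //= n <-; rewrite exprS.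
have := clique_char_poly.
rewrite eigE !X1 -(big_map (fun k => (c k)%:R - 1) xpredT (fun z => 'X - z%:P)).
rewrite -!big_cat => /prod_XsubC_eq perm_eig.
have := perm_big (op := +%R) (x := 0) (P := xpredT) (F := Num.norm) _ perm_eig.
rewrite !big_cat /= !big_nseq big_map normrN1 !iter_addr_0.
under [X in _ = _ + X]eq_bigr do rewrite clique_norm.
rewrite sumrB big_split /= -natr_sum sum_clique_card sumr_const.
rewrite -big_mkcond sumr_const -mulr_natr /energy => energyE.
apply: (addrI #|K|%:R); rewrite energyE; ring.
Qed.

End CliqueUnion.

Section ACGroup.

Variables (gT : finGroupType) (G : {group gT}).

Lemma AC_commuteE (a b : gT) :
  AC_group G -> a \in G :\: 'Z(G) -> b \in G :\: 'Z(G) ->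
  (a * b == b * a) = ('C_G[a] == 'C_G[b]).
Proof.
move=> acG.
(* The abelian group ['C_G[x]] contains [y], so all its elements commute with [y]. *)
have centS x y : x \in G :\: 'Z(G) -> y \in G :\: 'Z(G) -> commute x y ->
    'C_G[x] \subset 'C_G[y].
  move=> ncx /setDP[Gy _] cxy; rewrite subsetI subsetIl sub_cent1.
  by apply: (subsetP (acG x ncx)); rewrite inE Gy cent1C; apply/cent1P.
move=> nca ncb; apply/eqP/eqP => [cab | eqC].
  by apply/eqP; rewrite eqEsubset !centS.
have: a \in 'C_G[b] by rewrite -eqC inE cent1id andbT; case/setDP: nca.
by case/setIP=> _ /cent1P.
Qed.

End ACGroup.

Theorem theorem4 (C : numClosedFieldType) (gT : finGroupType) (G : {group gT}) :
  ~~ abelian G ->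
  AC_group G ->
  energy C (commuting_graph G) =
    (2%:R * (#|G|%:R - #|'Z(G)|%:R - #|noncentral_centralizers G|%:R))%R.
Proof.
move=> _ acG.
have ncE : noncentral_centralizers G =
    (fun a : commuting_graph G => 'C_G[val a]) @: [set: noncentral G].
  apply/setP=> A; apply/imsetP/imsetP => [[g ncg ->] | [a _ ->]].
    by exists (Sub g ncg : noncentral G); rewrite ?inE ?SubK.
  by exists (val a); rewrite ?(valP a).
(* Each vertex is labelled by its centralizer; the label type is all of [{set gT}], but only the
   image of the labelling is counted. *)
rewrite (@clique_energy C (commuting_graph G) _ (fun a => 'C_G[val a])) => [|a b].
  rewrite ncE; congr (_ * (_ - _))%R.
  by rewrite card_sig -natrB ?subset_leq_card ?center_sub // -cardsDS ?center_sub //.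
by rewrite -AC_commuteE ?(valP a) ?(valP b).
Qed.
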